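(* Let $\mathcal{G}^*$ be an anterial graph over a finite node set $V^*$, let $c$ and $o^{\mathrm{do}(c)}$ be two distinct single nodes of $V^*$ representing the variables $X_c$ and $X_o^{\mathrm{do}(c)}$, and let $L\subseteq U\subseteq V^*\setminus\{c,o^{\mathrm{do}(c)}\}$. Let the joint distribution of $X_o^{\mathrm{do}(c)}$, $X_c$, $X_U$ (and potentially other nuisance variables), i.e. of the variables represented by the nodes in $V^*$, be Markovian to $\mathcal{G}^*$. Run the Constrained Confounder Selection algorithm on the input $(\mathcal{G}^*,o^{\mathrm{do}(c)},c,L,U)$. (i) When the algorithm returns a set $S$, the set $S$ is an adjustment set that satisfies $L\subseteq S\subseteq U$. (ii) Suppose furthermore that the joint distribution of these variables is faithful to $\mathcal{G}^*$. Then $S$ is minimal, and if the algorithm returns ''no feasible set'', then there does not exist an adjustment set $S$ that satisfies $L\subseteq S\subseteq U$.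
   Context: Graphs. All graphs have a finite node set; two adjacent nodes are joined by exactly one edge, which is directed ($\rightarrow$), undirected ($-$) or bidirected ($\leftrightarrow$). A path is a sequence $\langle i_0,\dots,i_n\rangle$ of nodes in which consecutive nodes are adjacent; it is a semi-directed path from $i_0$ to $i_n$ if each edge between $i_m$ and $i_{m+1}$ is undirected or directed as $i_m\rightarrow i_{m+1}$; it is a semi-directed cycle if in addition $i_0=i_n$ and at least one edge is directed. A graph is anterial if (1) there is no semi-directed path between two nodes that are adjacent via a bidirected edge, and (2) it contains no semi-directed cycle. Separation. A walk is a sequence of nodes and edges joining consecutive nodes (repetitions allowed). A section of a walk is a maximal subwalk all of whose edges are undirected (possibly a single node). A section is a collider section if it contains neither end of the walk and the two edges of the walk preceding and following it both have an arrowhead (of a directed or bidirected edge) pointing into the section; all other sections are non-collider sections. A walk is connecting given $C$ if every collider section intersects $C$ and every non-collider section is disjoint from $C$. For disjoint $A,B,C$, $A\perp_{\mathcal G}B\,|\,C$ means that there is no walk between a node of $A$ and a node of $B$ that is connecting given $C$. Two graphs over the same nodes are Markov equivalent if they induce the same separations. Distributions. For a joint distribution $P$ of variables indexed by a node set, $A\perp\!\!\!\perp B\,|\,C$ denotes conditional independence of $X_A$ and $X_B$ given $X_C$. $P$ is Markovian (resp. faithful) to $\mathcal G$ if $A\perp_{\mathcal G}B\,|\,C\Rightarrow A\perp\!\!\!\perp B\,|\,C$ (resp. $\iff$) for all disjoint node sets $A,B,C$. Causal terminology. $X_c$ is the (observational) treatment variable and $X_o^{\mathrm{do}(c)}$ is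 the outcome variable under an intervention on $c$ at a fixed value; for the statement they are just two of the jointly distributed variables indexed by $V^*$. An adjustment set is a set $S\subseteq V^*\setminus\{c,o^{\mathrm{do}(c)}\}$ with $X_o^{\mathrm{do}(c)}\perp\!\!\!\perp X_c\,|\,X_S$. An adjustment set $S$ is minimal if no proper subset $S'\subsetneq S$ satisfies $X_o^{\mathrm{do}(c)}\perp\!\!\!\perp X_c\,|\,X_{S'}$. Known graph operations (on anterial graphs $\mathcal H$ over $W$). Marginalisation: for $M\subseteq W$, $\alpha_{\mathrm m}(\mathcal H;M)$ is an anterial graph over $W\setminus M$ such that for disjoint $A,B,D\subseteq W\setminus M$, $A\perp_{\mathcal H}B\,|\,D\iff A\perp_{\alpha_{\mathrm m}(\mathcal H;M)}B\,|\,D$; moreover $\alpha_{\mathrm m}(\alpha_{\mathrm m}(\mathcal H;M_1);M_2)=\alpha_{\mathrm m}(\mathcal H;M_1\cup M_2)$ for disjoint $M_1,M_2$. Conditioning: for $K\subseteq W$, $\alpha_{\mathrm c}(\mathcal H;K)$ is an anterial graph over $W\setminus K$ such that for disjoint $A,B,D\subseteq W\setminus K$, $A\perp_{\mathcal H}B\,|\,D\cup K\iff A\perp_{\alpha_{\mathrm c}(\mathcal H;K)}B\,|\,D$. Maximisation: $\max(\mathcal H)$ is a graph over $W$ that contains $\mathcal H$ as a subgraph, is Markov equivalent to $\mathcal H$, and is maximal, i.e. any two non-adjacent nodes $i,j$ of it are separated by some $D\subseteq W\setminus\{i,j\}$. Constrained Confounder Selection algorithm. Input: $\mathcal G^*$,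 $o^{\mathrm{do}(c)}$, $c$, $L$, $U$. 1. Let $\mathcal G^*_0=\alpha_{\mathrm m}\bigl(\alpha_{\mathrm c}(\mathcal G^*;L);V^*\setminus(U\cup\{c,o^{\mathrm{do}(c)}\})\bigr)$. 2. If $c$ is adjacent to $o^{\mathrm{do}(c)}$ in $\max(\mathcal G^*_0)$, return ''no feasible set''. 3. Otherwise put $n=0$, $S=U$, and repeat until no such node exists: select a node $i\in S\setminus L$ such that $c$ and $o^{\mathrm{do}(c)}$ are not adjacent in $\max(\mathcal G^*_{n+1})$, where $\mathcal G^*_{n+1}=\alpha_{\mathrm m}(\mathcal G^*_n;i)$; replace $S$ by $S\setminus\{i\}$ and $n$ by $n+1$. Then return $S$.
   Formalization: Minimality in (ii) is taken among sets containing L: no S' with L ⊆ S' ⊊ S satisfies the independence. With all proper subsets the claim fails, e.g. for the edgeless graph on {c, o, l} with L = U = {l} and constant variables, where ∅ also works. *)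

(* Defs.v *)
From HB Require Import structures.
From mathcomp Require Import all_boot all_order all_algebra.
From mathcomp Require Import all_classical all_reals all_analysis.

Set Implicit Arguments.
Unset Strict Implicit.
Unset Printing Implicit Defensive.

(* Both finset and classical_sets provide setT, setD, \bigcup, and so on; here
   [{set V}] is always a finite set of nodes (finset), and [set T] a classical
   set (events). *)

Section Graphs.
Variable V : finType.
Local Open Scope set_scope.

(* [(i, j) \in dir] is i -> j, [(i, j) \in und] is i - j and [(i, j) \in bid]
   is i <-> j.  The last conjunct says that two nodes are joined by at most one
   edge (the memberships are added as 0/1 numbers). *)
Definition simple_edges (nodes : {set V}) (dir und bid : {set V * V}) : bool :=
  [forall i, forall j,
    [&& [|| (i, j) \in dir, (i, j) \in und | (i, j) \in bid] ==>
          [&& i \in nodes, j \in nodes & i != j],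
        ((i, j) \in und) == ((j, i) \in und),
        ((i, j) \in bid) == ((j, i) \in bid) &
        ((i, j) \in dir) + ((j, i) \in dir)
          + ((i, j) \in und) + ((i, j) \in bid) <= 1]].

(* Graphs whose node set is any subset of the finite type V, so that operations
   deleting nodes stay within one type. *)
Record mgraph := MGraph {
  nodes : {set V};
  dir : {set V * V};
  und : {set V * V};
  bid : {set V * V};
  mgraphP : simple_edges nodes dir und bid }.

Definition adj (G : mgraph) : rel V :=
  fun i j =>
    [|| (i, j) \in dir G, (j, i) \in dir G, (i, j) \in und G | (i, j) \in bid G].

Definition semi_step (G : mgraph) : rel V :=
  fun i j => ((i, j) \in und G) || ((i, j) \in dir G).

(* The sequence <i_0, ..., i_n> is represented by its head i_0 and its tail. *)
Definition semi_directed_path (G : mgraph) (i j : V) (p : seq V) : bool :=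
  path (semi_step G) i p && (last i p == j).

Definition semi_directed_cycle (G : mgraph) (i : V) (p : seq V) : bool :=
  semi_directed_path G i i p && has (fun e => e \in dir G) (zip (i :: p) p).

Definition anterial (G : mgraph) : Prop :=
  (forall i j, (i, j) \in bid G -> forall p, ~~ semi_directed_path G i j p) /\
  (forall i p, ~~ semi_directed_cycle G i p).

(* Since two nodes are joined by at most one edge, a walk is determined by its
   sequence of nodes, again given as a head x and a tail p. *)
Definition walk (G : mgraph) (x : V) (p : seq V) : bool := path (adj G) x p.

Definition walk_node (x : V) (p : seq V) (k : nat) : V := nth x (x :: p) k.

Definition und_at (G : mgraph) (x : V) (p : seq V) (k : nat) : bool :=
  (walk_node x p k, walk_node x p k.+1) \in und G.

(* The subwalk on the positions a, ..., b is a section; the position of the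
   last node of the walk is [size p]. *)
Definition section (G : mgraph) (x : V) (p : seq V) (a b : nat) : Prop :=
  [/\ a <= b <= size p,
      forall k, a <= k < b -> und_at G x p k,
      0 < a -> ~~ und_at G x p a.-1
    & b < size p -> ~~ und_at G x p b].

(* The edge between i and j has an arrowhead at j. *)
Definition arrow_into (G : mgraph) (i j : V) : bool :=
  ((i, j) \in dir G) || ((i, j) \in bid G).

Definition collider_section (G : mgraph) (x : V) (p : seq V) (a b : nat) : bool :=
  [&& 0 < a, b < size p,
      arrow_into G (walk_node x p a.-1) (walk_node x p a) &
      arrow_into G (walk_node x p b.+1) (walk_node x p b)].

Definition section_meets (C : {set V}) (x : V) (p : seq V) (a b : nat) : Prop :=
  exists2 k, a <= k <= b & walk_node x p k \in C.

Definition connecting (G : mgraph) (C : {set V}) (x : V) (p : seq V) : Prop :=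
  walk G x p /\
  forall a b, section G x p a b ->
    if collider_section G x p a b then section_meets C x p a b else ~ section_meets C x p a b.

Definition disjoint3 (A B C : {set V}) : bool :=
  [&& [disjoint A & B], [disjoint A & C] & [disjoint B & C]].

Definition gsep (G : mgraph) (A B C : {set V}) : Prop :=
  ~ exists x p, [/\ x \in A, last x p \in B & connecting G C x p].

Definition markov_equivalent (G H : mgraph) : Prop :=
  nodes G = nodes H /\
  forall A B C : {set V}, disjoint3 A B C -> A :|: B :|: C \subset nodes G ->
    (gsep G A B C <-> gsep H A B C).

Definition subgraph (G H : mgraph) : Prop :=
  [/\ nodes G \subset nodes H, dir G \subset dir H,
      und G \subset und H & bid G \subset bid H].

Definition maximal_graph (G : mgraph) : Prop :=
  forall i j, i \in nodes G -> j \in nodes G -> i != j -> ~~ adj G i j ->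
    exists2 D : {set V}, D \subset nodes G :\: [set i; j] &
      gsep G [set i] [set j] D.

Definition marginalisation (alpha_m : mgraph -> {set V} -> mgraph) : Prop :=
  forall (H : mgraph) (M : {set V}), anterial H -> M \subset nodes H ->
  [/\ anterial (alpha_m H M), nodes (alpha_m H M) = nodes H :\: M,
      forall A B D : {set V}, disjoint3 A B D ->
        A :|: B :|: D \subset nodes H :\: M ->
        (gsep H A B D <-> gsep (alpha_m H M) A B D)
    & forall M' : {set V}, M' \subset nodes H -> [disjoint M & M'] ->
        alpha_m (alpha_m H M) M' = alpha_m H (M :|: M')].

Definition conditioning (alpha_c : mgraph -> {set V} -> mgraph) : Prop :=
  forall (H : mgraph) (K : {set V}), anterial H -> K \subset nodes H ->
  [/\ anterial (alpha_c H K), nodes (alpha_c H K) = nodes H :\: K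
    & forall A B D : {set V}, disjoint3 A B D ->
        A :|: B :|: D \subset nodes H :\: K ->
        (gsep H A B (D :|: K) <-> gsep (alpha_c H K) A B D)].

Definition maximisation (gmax : mgraph -> mgraph) : Prop :=
  forall H, anterial H ->
  [/\ nodes (gmax H) = nodes H, subgraph H (gmax H),
      markov_equivalent (gmax H) H & maximal_graph (gmax H)].

(* The algorithm selects nodes arbitrarily, so it is a relation between its
   input and its possible outputs. *)
Section ConfounderSelection.
Variables (alpha_m alpha_c : mgraph -> {set V} -> mgraph).
Variable gmax : mgraph -> mgraph.

(* [selection_loop o c L G S S'] : started with the current graph G and the
   current set S, the loop can end with the set S'. *)
Inductive selection_loop (o c : V) (L : {set V}) :
    mgraph -> {set V} -> {set V} -> Prop :=
| loop_stop (G : mgraph) (S : {set V}) :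
    (forall i, i \in S :\: L -> adj (gmax (alpha_m G [set i])) c o) ->
    selection_loop o c L G S S
| loop_step (G : mgraph) (S S' : {set V}) (i : V) :
    i \in S :\: L ->
    ~~ adj (gmax (alpha_m G [set i])) c o ->
    selection_loop o c L (alpha_m G [set i]) (S :\ i) S' ->
    selection_loop o c L G S S'.

Definition initial_graph (G : mgraph) (o c : V) (L U : {set V}) : mgraph :=
  alpha_m (alpha_c G L) (nodes G :\: (U :|: [set c; o])).

(* The output [None] stands for the answer "no feasible set". *)
Inductive confounder_selection (G : mgraph) (o c : V) (L U : {set V}) :
    option {set V} -> Prop :=
| selection_infeasible :
    adj (gmax (initial_graph G o c L U)) c o ->
    confounder_selection G o c L U None
| selection_returns (S : {set V}) :
    ~~ adj (gmax (initial_graph G o c L U)) c o ->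
    selection_loop o c L (initial_graph G o c L U) U S ->
    confounder_selection G o c L U (Some S).

End ConfounderSelection.
End Graphs.

Section ConditionalIndependence.
Context {d : measure_display} {Omega : measurableType d} {R : realType}.
Variable P : probability Omega R.
Local Open Scope classical_set_scope.

(* g is a version of the conditional probability of the event E given the
   sub-sigma-algebra F. *)
Definition cond_prob (F : set (set Omega)) (E : set Omega) (g : Omega -> R) :
    Prop :=
  [/\ forall B : set R, measurable B -> F (g @^-1` B),
      P.-integrable setT (EFin \o g)
    & forall H, F H -> (\int[P]_(w in H) (g w)%:E = P (E `&` H))%E].

(* P(E `&` E' | F) = P(E | F) P(E' | F) almost surely for all E in FA and E' in
   FB.  Versions always exist and are almost surely unique, so asking for some
   versions is the same as asking for all of them. *)
Definition cond_indep_sigma (FA FB F : set (set Omega)) : Prop :=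
  forall E E', FA E -> FB E' ->
    exists g g', [/\ cond_prob F E g, cond_prob F E' g'
                   & cond_prob F (E `&` E') (fun w => g w * g' w)%R].

Variable V : finType.
Context {dT : V -> measure_display} {T : forall v, measurableType (dT v)}.
Variable X : forall v, {RV P >-> T v}.

(* The sigma-algebra on Omega generated by the variables X_v, v in A. *)
Definition sigma_of (A : {set V}) : set (set Omega) :=
  <<s [set E | exists v, v \in A /\
                 exists2 B : set (T v), measurable B & E = X v @^-1` B] >>.

Definition cond_indep (A B C : {set V}) : Prop :=
  cond_indep_sigma (sigma_of A) (sigma_of B) (sigma_of C).

Local Close Scope classical_set_scope.
Local Open Scope set_scope.

Definition markovian_to (G : mgraph V) : Prop :=
  forall A B C : {set V}, disjoint3 A B C ->
    A :|: B :|: C \subset nodes G ->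
    gsep G A B C -> cond_indep A B C.

Definition faithful_to (G : mgraph V) : Prop :=
  forall A B C : {set V}, disjoint3 A B C ->
    A :|: B :|: C \subset nodes G ->
    (gsep G A B C <-> cond_indep A B C).

Definition adjustment_set (o c : V) (S : {set V}) : Prop :=
  [disjoint S & [set c; o]] /\ cond_indep [set o] [set c] S.

(* Minimality among the sets that contain the required covariates L; for
   L = set0 no proper subset of S at all is an adjustment set.  For other L
   the output may have smaller adjustment sets not containing L (e.g. when a
   node of L is isolated in the graph), so L has to be kept. *)
Definition minimal_adjustment_set (o c : V) (L S : {set V}) : Prop :=
  adjustment_set o c S /\
  forall S' : {set V}, L \subset S' -> S' \proper S ->
    ~ cond_indep [set o] [set c] S'.

End ConditionalIndependence.

(* Main.v *)
(* The algorithm maintains graphs over (S \ L) + {c, o} in which a set D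
   separates o from c exactly when D + L separates them in G; adjacency in a
   maximal graph then says that no subset of S containing L separates o from c
   in G.  When the loop stops at S, some D between L and S separates, but none
   that avoids a node of S \ L does; hence D = S, and S is minimal. *)
Require Import Defs.
From HB Require Import structures.
From mathcomp Require Import all_boot all_order all_algebra.
From mathcomp Require Import all_classical all_reals all_analysis.

Set Implicit Arguments.
Unset Strict Implicit.
Unset Printing Implicit Defensive.

Section Selection.
Import fintype boot.finset.
Local Open Scope set_scope.

Lemma adj_sym (V : finType) (G : mgraph V) : symmetric (adj G).
Proof.
move=> i j; rewrite /adj.
have /forallP/(_ i)/forallP/(_ j)/and4P[_ /eqP-> /eqP-> _] := mgraphP G.
by rewrite orbCA.
Qed.

(** The single edge is itself a connecting walk: a collider section needs [0 < a <= b < 1], so there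
    is none, and the only nodes met are [i] and [j], both outside [D]. *)
Lemma adj_not_gsep (V : finType) (G : mgraph V) (i j : V) (D : {set V}) :
  adj G i j -> i \notin D -> j \notin D -> ~ gsep G [set i] [set j] D.
Proof.
move=> Gij iD jD; apply; exists i, [:: j]; split; rewrite ?inE //.
split; first by rewrite /walk /= Gij.
move=> a b [/andP[ab b1] _ _ _].
have -> : collider_section G i [:: j] a b = false.
  by apply/and4P => -[a0 blt _ _]; case: b ab blt {b1} => [|b] //; case: a a0.
case=> k /andP[_ kb]; have : k <= 1 := leq_trans kb b1.
by case: k {kb} => [|[|//]] _ /=; rewrite ?(negPf iD) ?(negPf jD).
Qed.

(** Maximality provides a separating set for a non-adjacent pair of [gmax H], and Markov equivalence
    carries it to [H]. Conversely, a separation in [H] holds in [gmax H] too, where an edge would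
    rule it out. *)
Lemma gmax_adjP (V : finType) (gmax : mgraph V -> mgraph V) (H : mgraph V)
    (i j : V) :
  maximisation gmax -> anterial H -> i \in nodes H -> j \in nodes H -> i != j ->
  ~~ adj (gmax H) i j <->
  exists2 D : {set V}, D \subset nodes H :\: [set i; j]
                     & gsep H [set i] [set j] D.
Proof.
move=> Hmax antH iH jH nij.
have [nodesE _ [_ eqv] maxH] := Hmax H antH.
have sepE (D : {set V}) : D \subset nodes H :\: [set i; j] ->
    [/\ i \notin D, j \notin D
      & gsep (gmax H) [set i] [set j] D <-> gsep H [set i] [set j] D].
  move=> sD.
  have iD : i \notin D by apply/negP => /(subsetP sD); rewrite !inE eqxx.
  have jD : j \notin D by apply/negP => /(subsetP sD); rewrite !inE eqxx orbT.
  split=> //; apply: eqv.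
    by rewrite /disjoint3 !disjoints1 !inE nij iD jD.
  rewrite nodesE !subUset !sub1set iH jH /=.
  exact: subset_trans sD (subsetDl _ _).
split=> [nadj|[D sD sepD]].
  have [||D sD sepD] := maxH i j _ _ nij nadj; rewrite ?nodesE //.
  by rewrite nodesE in sD; exists D => //; have [_ _ <-] := sepE D sD.
have [iD jD eqD] := sepE D sD.
by apply/negP => /adj_not_gsep/(_ iD jD); apply; apply/eqD.
Qed.

(** The loop invariant linking the current graph [H] to the input [G]. As [H] has been conditioned
    on [L], the nodes of [L] are absent from it and reappear in the separating set on the side of
    [G]. *)
Definition selection_graph (V : finType) (G : mgraph V) (o c : V)
    (L S : {set V}) (H : mgraph V) : Prop :=
  [/\ anterial H, nodes H = (S :\: L) :|: [set c; o]
    & forall D : {set V}, D \subset S :\: L ->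
        gsep H [set o] [set c] D <-> gsep G [set o] [set c] (D :|: L)].

Lemma disjoint3_nodes (V : finType) (o c : V) (S D : {set V}) :
  c != o -> c \notin S -> o \notin S -> D \subset S ->
  disjoint3 [set o] [set c] D.
Proof.
move=> nco cS oS sDS; rewrite /disjoint3 !disjoints1 inE eq_sym nco /=.
by rewrite (contra (subsetP sDS o) oS) (contra (subsetP sDS c) cS).
Qed.

Lemma selection_graph_marginal (V : finType) (alpha_m : mgraph V -> {set V} -> mgraph V)
    (G : mgraph V) (o c : V) (L S : {set V}) (H : mgraph V) (i : V) :
  marginalisation alpha_m -> c != o -> c \notin S -> o \notin S ->
  selection_graph G o c L S H -> i \in S :\: L ->
  selection_graph G o c L (S :\ i) (alpha_m H [set i]).
Proof.
move=> Hm nco cS oS [antH nodesE sepH] iSL.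
have iH : [set i] \subset nodes H by rewrite sub1set nodesE inE iSL.
have [antM nodesM sepM _] := Hm H _ antH iH.
have [iL iS] : i \notin L /\ i \in S by move: iSL; rewrite inE => /andP[].
have nci : c != i by apply: contraNneq cS => ->.
have noi : o != i by apply: contraNneq oS => ->.
have nodesME : nodes H :\: [set i] = ((S :\ i) :\: L) :|: [set c; o].
  apply/setP => x; rewrite nodesE !inE.
  (* At [x = i] both sides are false, since [i] lies in [S] and so is neither [c] nor [o]. *)
  by case: (eqVneq x i) => [->|_]; rewrite ?andbF ?(eq_sym i) ?(negPf nci) ?(negPf noi).
split; rewrite ?nodesM // => D sD.
have sDS : D \subset S :\: L by rewrite (subset_trans sD) // setSD // subD1set.
rewrite -(sepH D sDS); apply: iff_sym; apply: sepM.
  exact: (disjoint3_nodes nco cS oS (subset_trans sDS (subsetDl _ _))).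
rewrite nodesME !subUset !sub1set !inE !eqxx !orbT /=.
exact: subset_trans sD (subsetUl _ _).
Qed.

(** Conditioning trades [D] for [D :|: L]; the marginalisation that follows keeps separations among
    the surviving nodes. *)
Lemma selection_graph_initial (V : finType)
    (alpha_m alpha_c : mgraph V -> {set V} -> mgraph V)
    (G : mgraph V) (o c : V) (L U : {set V}) :
  marginalisation alpha_m -> conditioning alpha_c -> anterial G -> c != o ->
  c \in nodes G -> o \in nodes G ->
  c \notin U -> o \notin U -> L \subset U -> U \subset nodes G ->
  selection_graph G o c L U (initial_graph alpha_m alpha_c G o c L U).
Proof.
move=> Hm Hc antG nco cG oG cU oU sLU sUG.
have [antC nodesC sepC] := Hc G L antG (subset_trans sLU sUG).
have cL := contra (subsetP sLU c) cU; have oL := contra (subsetP sLU o) oU.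
(* Since [L] is part of [U], no node to be marginalised was already removed by the conditioning. *)
have sM : nodes G :\: (U :|: [set c; o]) \subset nodes (alpha_c G L).
  by rewrite nodesC setDS // (subset_trans sLU) // subsetUl.
have [antM nodesM sepM _] := Hm _ _ antC sM.
have nodesME : nodes (alpha_c G L) :\: (nodes G :\: (U :|: [set c; o])) =
    (U :\: L) :|: [set c; o].
  apply/setP => x; rewrite nodesC !inE.
  case: (eqVneq x c) => [->|_]; first by rewrite cG cL !orbT.
  case: (eqVneq x o) => [->|_]; first by rewrite oG oL !orbT.
  rewrite !orbF; case: (boolP (x \in U)) => [/(subsetP sUG) ->|_] /=.
    by rewrite !andbT.
  by case: (x \in nodes G); rewrite /= ?andbF.
rewrite /initial_graph; split; rewrite ?nodesM // => D sD.
have dis := disjoint3_nodes nco cU oU (subset_trans sD (subsetDl _ _)).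
have sN : [set o] :|: [set c] :|: D \subset (U :\: L) :|: [set c; o].
  rewrite !subUset !sub1set !inE !eqxx !orbT /=.
  exact: subset_trans sD (subsetUl _ _).
have sND : [set o] :|: [set c] :|: D \subset nodes G :\: L.
  by rewrite -nodesC (subset_trans sN) // -nodesME subsetDl.
by rewrite (sepC _ _ _ dis sND); apply: iff_sym; apply: sepM; rewrite ?nodesME.
Qed.

(** Adding and removing [L] matches the subsets of [S :\: L] with the sets between [L] and [S],
    which turns the adjacency test on [H] into a statement about [G] alone. *)
Lemma selection_graph_adjP (V : finType) (gmax : mgraph V -> mgraph V)
    (G : mgraph V) (o c : V) (L S : {set V}) (H : mgraph V) :
  maximisation gmax -> c != o -> c \notin S -> o \notin S -> L \subset S ->
  selection_graph G o c L S H ->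
  ~~ adj (gmax H) c o <->
  exists D : {set V},
    [/\ L \subset D, D \subset S & gsep G [set o] [set c] D].
Proof.
move=> Hmax nco cS oS sLS [antH nodesE sepH].
have subE : nodes H :\: [set o; c] = S :\: L.
  apply/setP => x; rewrite nodesE !inE.
  case: (eqVneq x c) => [->|_]; first by rewrite (negPf cS) !orbT !andbF.
  by case: (eqVneq x o) => [->|_]; rewrite ?(negPf oS) ?andbF ?orbF.
have oH : o \in nodes H by rewrite nodesE !inE eqxx !orbT.
have cH : c \in nodes H by rewrite nodesE !inE eqxx !orbT.
rewrite adj_sym (gmax_adjP Hmax antH oH cH) 1?eq_sym // subE; split.
  move=> [D sD /(sepH D sD) sepD]; exists (D :|: L); split=> //.
    exact: subsetUr.
  by rewrite subUset sLS (subset_trans sD) // subsetDl.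
move=> [D [sLD sDS sepD]]; have sDL := setSD L sDS.
exists (D :\: L) => //; apply/(sepH _ sDL).
(* Writing [L] as [D :&: L] exhibits the union as the splitting of [D] along [L]. *)
by rewrite setUC -[X in X :|: _](setIidPr sLD) setID.
Qed.

Lemma selection_loopP (V : finType) (alpha_m : mgraph V -> {set V} -> mgraph V)
    (gmax : mgraph V -> mgraph V) (G : mgraph V) (o c : V)
    (L S S' : {set V}) (H : mgraph V) :
  marginalisation alpha_m -> maximisation gmax -> c != o ->
  c \notin S -> o \notin S -> L \subset S ->
  selection_graph G o c L S H -> ~~ adj (gmax H) c o ->
  selection_loop alpha_m gmax o c L H S S' ->
  [/\ L \subset S', S' \subset S, gsep G [set o] [set c] S'
    & forall D : {set V}, L \subset D -> D \proper S' ->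
        ~ gsep G [set o] [set c] D].
Proof.
(* The facts about [S] and [H] stay in the goal, so that the induction can restate them for the
   smaller set and the marginalised graph. *)
move=> Hm Hmax nco + + + + + loop.
elim: {H S S'} loop => [H S stop|H S S' i iSL nadj _ IH] cS oS sLS HS nadjH.
  (* A proper subset [D] misses some [i] of [S], and [i] is not in [L] because [D] contains [L]. So
     the stopping test covers [i], while [D] would be a separator within [S :\ i]. *)
  have noSep (D : {set V}) :
      L \subset D -> D \proper S -> ~ gsep G [set o] [set c] D.
    move=> sLD /properP[sDS [i iS iD]] sepD.
    have iSL : i \in S :\: L by rewrite inE iS (contra (subsetP sLD i)).
    have := stop i iSL; apply/negP.
    apply/(selection_graph_adjP Hmax nco _ _ _
             (selection_graph_marginal Hm nco cS oS HS iSL)).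
    - by rewrite inE (negPf cS) andbF.
    - by rewrite inE (negPf oS) andbF.
    - by rewrite subsetD1 sLS (contra (subsetP sLD i)).
    - by exists D; rewrite subsetD1 sDS iD.
  (* Non-adjacency in the current graph gives some separator between [L] and [S]; [noSep] forces it
     to be [S] itself. *)
  have [D [sLD sDS sepD]] :=
    (selection_graph_adjP Hmax nco cS oS sLS HS).1 nadjH.
  split=> //; case: (eqVproper sDS) => [<- //|pDS].
  by case: (noSep D sLD pDS).
have [iL iS] : i \notin L /\ i \in S by move: iSL; rewrite inE => /andP[].
have [|||||sLS' sS'S sepS' minS'] := IH.
- by rewrite inE (negPf cS) andbF.
- by rewrite inE (negPf oS) andbF.
- by rewrite subsetD1 sLS iL.
- exact: selection_graph_marginal.
- exact: nadj.
by split=> //; rewrite (subset_trans sS'S) // subD1set.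
Qed.

End Selection.

Theorem theorem5
  (V : finType) (G : mgraph V) (o c : V) (L U : {set V})
  (alpha_m alpha_c : mgraph V -> {set V} -> mgraph V)
  (gmax : mgraph V -> mgraph V)
  (d : measure_display) (Omega : measurableType d) (R : realType)
  (P : probability Omega R)
  (dT : V -> measure_display) (T : forall v : V, measurableType (dT v))
  (X : forall v : V, {RV P >-> T v})
  (Halpha_m : marginalisation alpha_m)
  (Halpha_c : conditioning alpha_c)
  (Hgmax : maximisation gmax)
  (HV : nodes G = [set: V]%SET)
  (HG : anterial G)
  (Hco : c != o)
  (HLU : L \subset U)
  (HU : U \subset [set: V]%SET :\: [set c; o]%SET)
  (HP : markovian_to X G) :
  (forall S : {set V},
      confounder_selection alpha_m alpha_c gmax G o c L U (Some S) ->
      adjustment_set X o c S /\ L \subset S /\ S \subset U) /\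
  (faithful_to X G ->
    (forall S : {set V},
        confounder_selection alpha_m alpha_c gmax G o c L U (Some S) ->
        minimal_adjustment_set X o c L S) /\
    (confounder_selection alpha_m alpha_c gmax G o c L U None ->
      ~ exists S : {set V},
          adjustment_set X o c S /\ L \subset S /\ S \subset U)).
Proof.
have cU : c \notin U by apply/negP => /(fintype.subsetP HU); rewrite !inE eqxx.
have oU : o \notin U by apply/negP => /(fintype.subsetP HU); rewrite !inE eqxx orbT.
have inG v : v \in nodes G by rewrite HV inE.
have subG (A : {set V}) : A \subset nodes G by rewrite HV finset.subsetT.
have init : selection_graph G o c L U (initial_graph alpha_m alpha_c G o c L U).
  exact: selection_graph_initial.
have dis (S : {set V}) : S \subset U -> disjoint3 [set o]%SET [set c]%SET S.
  exact: disjoint3_nodes.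
(* Everything up to here is purely graphical; the distribution enters only when separations are
   translated into independences. *)
have output (S : {set V}) :
    confounder_selection alpha_m alpha_c gmax G o c L U (Some S) ->
    [/\ L \subset S, S \subset U, gsep G [set o]%SET [set c]%SET S
      & forall D : {set V}, L \subset D -> D \proper S ->
          ~ gsep G [set o]%SET [set c]%SET D].
  move=> run; inversion run as [|S0 nadj loop]; subst S0.
  exact: (selection_loopP Halpha_m Hgmax Hco cU oU HLU init).
have adjustment (S : {set V}) :
    confounder_selection alpha_m alpha_c gmax G o c L U (Some S) ->
    adjustment_set X o c S /\ L \subset S /\ S \subset U.
  move=> /output[sLS sSU sepS _]; split=> //; split; last exact: HP (dis _ sSU) _ _.
  rewrite disjoint_sym finset.disjoints_subset finset.subUset !finset.sub1set !inE.
  by rewrite !(contra (fintype.subsetP sSU _)).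
split=> // faith; split=> [S run|run [S [[_ indepS] [sLS sSU]]]].
  have [_ sSU _ minS] := output S run.
  split=> [|S' sLS' pS'S indepS']; first by have [] := adjustment S run.
  (* Faithfulness turns the independence given [S'] back into a separation, which [minS] forbids. *)
  apply: (minS S' sLS' pS'S); apply/faith => //.
  exact/dis/(fintype.subset_trans (proper_sub pS'S)).
inversion run as [adj_co|].
move: adj_co; apply/negP.
(* An adjustment set between [L] and [U] would, by faithfulness, be a separator, so [c] and [o]
   could not be adjacent at the initial test. *)
apply/(selection_graph_adjP Hgmax Hco cU oU HLU init).
by exists S; split=> //; apply/faith => //; exact: dis.
Qed.
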